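(* For every $n\ge 2$, $\mathsf{VSB}_n\equiv_{\mathrm{sW}}\mathsf{C}_\mathbb{N}$.
   Context: A Weihrauch problem is a relation between instances and solutions (coded as elements of $\mathbb{N}^\mathbb{N}$ or $\mathbb{N}$). $P\le_{\mathrm{sW}}Q$ if there are computable functionals $\Phi,\Psi$ such that for every instance $S$ of $P$, $\Phi(S)$ is an instance of $Q$ and for every solution $R$ of $\Phi(S)$, $\Psi(R)$ is a solution of $S$; $\equiv_{\mathrm{sW}}$ is the induced equivalence. $\mathsf{C}_\mathbb{N}$: instances are non-surjective $f\colon\mathbb{N}\to\mathbb{N}$, solutions are $m\notin\operatorname{range}(f)$. $\mathsf{VSB}_n$: instances are countable vector spaces (over a countable field, given as part of the instance) of dimension exactly $n$; solutions are bases. *)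

(* Defs.v *)
From mathcomp Require Import all_boot all_order all_algebra.
From Stdlib Require Cantor.

Set Implicit Arguments.
Unset Strict Implicit.
Unset Printing Implicit Defensive.

Definition baire := nat -> nat.

(** Kleene's partial recursive functions relative to an oracle [p : baire].
    Argument lists are untyped: a missing argument of a basic function is
    read as 0. *)
Inductive prog : Type :=
| Zero
| Succ
| Proj of nat
| Oracle
| Comp of prog & seq prog
| PrimRec of prog & prog
| Mu of prog.

(** [eval p c xs y]: with oracle [p], the program [c] halts on the arguments
    [xs] with value [y]. *)
Inductive eval (p : baire) : prog -> seq nat -> nat -> Prop :=
| EvalZero xs : eval p Zero xs 0
| EvalSucc xs : eval p Succ xs (nth 0 xs 0).+1
| EvalProj i xs : eval p (Proj i) xs (nth 0 xs i)
| EvalOracle xs : eval p Oracle xs (p (nth 0 xs 0))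
| EvalComp c ds xs ys y :
    size ys = size ds ->
    (forall i, i < size ds -> eval p (nth Zero ds i) xs (nth 0 ys i)) ->
    eval p c ys y ->
    eval p (Comp c ds) xs y
| EvalPrimRec0 c d xs y :
    eval p c xs y ->
    eval p (PrimRec c d) (0 :: xs) y
| EvalPrimRecS c d n xs z y :
    eval p (PrimRec c d) (n :: xs) z ->
    eval p d (n :: z :: xs) y ->
    eval p (PrimRec c d) (n.+1 :: xs) y
| EvalMu c xs y (z : nat -> nat) :
    (forall i, i < y -> eval p c (i :: xs) (z i).+1) ->
    eval p c (y :: xs) 0 ->
    eval p (Mu c) xs y.

Lemma eval_functional p c xs y y' :
  eval p c xs y -> eval p c xs y' -> y = y'.
Proof.
move=> ev; elim: ev y' => {c xs y}.
- by move=> xs y' ev; inversion ev.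
- by move=> xs y' ev; inversion ev.
- by move=> i xs y' ev; inversion ev.
- by move=> xs y' ev; inversion ev.
- move=> c ds xs ys y sz _ IHds _ IHc y' ev.
  inversion ev as [| | | |c' ds' xs' ys' y'' sz' ev_ds ev_c| | |]; subst.
  apply: IHc; suff -> : ys = ys' by [].
  apply: (@eq_from_nth _ 0) => [|i]; rewrite ?sz ?sz' // => lt_i.
  by apply: IHds => //; apply: ev_ds.
- by move=> c d xs y _ IH y' ev; inversion ev; subst; apply: IH.
- move=> c d n xs z y _ IHz _ IHy y' ev.
  inversion ev as [| | | | | |c' d' n' xs' z' y'' ev_z ev_y|]; subst.
  by apply: IHy; rewrite (IHz _ ev_z).
- move=> c xs y z _ IHlt _ IH0 y' ev.
  inversion ev as [| | | | | | |c' xs' y'' z' ev_lt ev_0]; subst.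
  case: (ltngtP y y') => // lt_yy'.
    by have := IH0 _ (ev_lt _ lt_yy').
  by have := IHlt _ lt_yy' _ ev_0.
Qed.

(** The partial computable functional on Baire space with index [c] is
    defined at [p], with value [q]. *)
Definition computes (c : prog) (p q : baire) : Prop :=
  forall k, eval p c [:: k] (q k).

Record problem := Problem {
  is_instance : baire -> Prop;
  is_solution : baire -> baire -> Prop
}.

Definition sW_le (P Q : problem) : Prop :=
  exists Phi Psi : prog, forall S, is_instance P S ->
    exists T, [/\ computes Phi S T, is_instance Q T &
      forall R, is_solution Q T R ->
        exists B, computes Psi R B /\ is_solution P S B].

Definition sW_equiv (P Q : problem) : Prop := sW_le P Q /\ sW_le Q P.

(** A natural number [m] is named by every [R : baire] with [R 0 = m]. *)
Definition C_N : problem := {|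
  is_instance f := exists m, forall k, f k <> m;
  is_solution f R := forall k, f k <> R 0
|}.

Definition char_fun (A : nat -> Prop) (q : baire) : Prop :=
  forall k, (A k /\ q k = 1) \/ (~ A k /\ q k = 0).

Definition column (p : baire) (i : nat) : baire :=
  fun k => p (Cantor.to_nat (i, k)).

Definition op2 (q : baire) (x y : nat) : nat := q (Cantor.to_nat (x, y)).

Local Open Scope ring_scope.

(** [p] codes a field with universe a subset of [nat] and a vector space over
    it with universe a subset of [nat]; [cK] and [cV] identify [K] and [V]
    with the coded structures.  The columns of [p] are, in order: |K|, +_K,
    *_K, 0_K, 1_K, |V|, +_V, scalar multiplication, 0_V.  The values of an
    operation outside the universe are arbitrary. *)
Definition codes_space (p : baire) (K : fieldType) (V : vectType K)
    (cK : K -> nat) (cV : V -> nat) : Prop :=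
  [/\ injective cK,
      char_fun (fun k => exists a, cK a = k) (column p 0),
      (forall a b, op2 (column p 1) (cK a) (cK b) = cK (a + b)),
      (forall a b, op2 (column p 2) (cK a) (cK b) = cK (a * b)) &
      column p 3 0%N = cK 0 /\ column p 4 0%N = cK 1]
  /\
  [/\ injective cV,
      char_fun (fun k => exists v, cV v = k) (column p 5),
      (forall u v, op2 (column p 6) (cV u) (cV v) = cV (u + v)),
      (forall a v, op2 (column p 7) (cK a) (cV v) = cV (a *: v)) &
      column p 8 0%N = cV 0].

(** A basis is given by the characteristic function of the set of (codes of)
    its elements. *)
Definition VSB (n : nat) : problem := {|
  is_instance p :=
    exists (K : fieldType) (V : vectType K) (cK : K -> nat) (cV : V -> nat),
      codes_space p cK cV /\ \dim {:V} = n;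
  is_solution p R :=
    exists (K : fieldType) (V : vectType K) (cK : K -> nat) (cV : V -> nat),
      [/\ codes_space p cK cV, \dim {:V} = n &
        exists2 b : seq V, basis_of {:V} b &
          char_fun (fun k => exists2 v, v \in b & cV v = k) R]
|}.

(* Main.v *)
(** To reduce VSB_n to C_N, enumerate the codes of the [n]-tuples that are seen
    not to be bases: an entry lies outside the universe, or a nontrivial linear
    combination vanishes.  A tuple which is never enumerated is a basis.

    Conversely, approximate a number outside the range of [f]: the candidate is
    increased by one whenever it is found among the values of [f].  Build a
    presentation of Q^n in which a code carries a claim [g] and its coordinate 1 is the coefficient of a vector [e_g].  While [g] is the current
    candidate, [e_g] is independent of the other basis vectors; once [g] is
    refuted, [e_g] is declared to be a multiple [q e_0] of [e_0], with [q] so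
    large that no linear relation between the vectors of code at most the
    current stage is created.  Thus relations are decided at a finite stage,
    and only the codes claiming the final candidate can have a nonzero
    coordinate 1.  As [n >= 2], every basis contains such a code, and no nonzero
    vector claims more, so the largest claim in a basis is the final candidate. *)

Require Import Defs.
From mathcomp Require Import all_boot all_order all_algebra.
From mathcomp Require Import ring zify.
From Stdlib Require Cantor Classical_Prop.

Set Implicit Arguments.
Unset Strict Implicit.
Unset Printing Implicit Defensive.

Import Order.TTheory GRing.Theory Num.Theory.

Local Open Scope nat_scope.

(** * Computable functionals *)

Section Computable.

(* [I] indexes the admissible oracles; taking for it a subtype of [baire] makes
   totality a matter of a promise, as for a search that ends on instances only. *)
Variables (I : Type) (o : I -> baire).

Definition computable k (F : I -> seq nat -> nat) : Prop :=
  exists c, forall i xs, size xs = k -> eval (o i) c xs (F i xs).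

Lemma computable_ext k F G :
  (forall i xs, size xs = k -> F i xs = G i xs) ->
  computable k F -> computable k G.
Proof. by move=> eFG [c cP]; exists c => i xs sz; rewrite -eFG //; apply: cP. Qed.

Lemma computable_var k j : computable k (fun _ xs => nth 0 xs j).
Proof. by exists (Proj j) => i xs _; constructor. Qed.

Lemma computable_comp m k G (Fs : seq (I -> seq nat -> nat)) :
  size Fs = m -> foldr (fun F P => computable k F /\ P) True Fs ->
  computable m G -> computable k (fun i xs => G i [seq F i xs | F <- Fs]).
Proof.
move=> szF FsP [c cP].
suff [ds szd dsP]: exists2 ds, size ds = size Fs & forall i xs j, size xs = k ->
    j < size ds -> eval (o i) (nth Zero ds j) xs (nth 0 [seq F i xs | F <- Fs] j).
  exists (Comp c ds) => i xs sz; apply: EvalComp (cP _ _ _).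
  - by rewrite size_map szd.
  - by move=> j; apply: dsP.
  - by rewrite size_map.
elim: Fs {szF} FsP => [_|F Fs IH [[d dP] /IH[ds szd dsP]]]; first by exists [::].
exists (d :: ds) => [|i xs [|j] sz /=]; first by rewrite /= szd.
  by move=> _; apply: dP.
by apply: dsP.
Qed.

Lemma computable_call1 k (g : I -> nat -> nat) F :
  computable 1 (fun i xs => g i (nth 0 xs 0)) ->
  computable k F -> computable k (fun i xs => g i (F i xs)).
Proof. by move=> cg cF; apply: (@computable_comp 1 k _ [:: F]) cg. Qed.

Lemma computable_call2 k (g : I -> nat -> nat -> nat) F1 F2 :
  computable 2 (fun i xs => g i (nth 0 xs 0) (nth 0 xs 1)) ->
  computable k F1 -> computable k F2 ->
  computable k (fun i xs => g i (F1 i xs) (F2 i xs)).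
Proof. by move=> cg *; apply: (@computable_comp 2 k _ [:: F1; F2]) cg. Qed.

Lemma computable_call3 k (g : I -> nat -> nat -> nat -> nat) F1 F2 F3 :
  computable 3 (fun i xs => g i (nth 0 xs 0) (nth 0 xs 1) (nth 0 xs 2)) ->
  computable k F1 -> computable k F2 -> computable k F3 ->
  computable k (fun i xs => g i (F1 i xs) (F2 i xs) (F3 i xs)).
Proof. by move=> cg *; apply: (@computable_comp 3 k _ [:: F1; F2; F3]) cg. Qed.

Lemma computable_call4 k (g : I -> nat -> nat -> nat -> nat -> nat) F1 F2 F3 F4 :
  computable 4
    (fun i xs => g i (nth 0 xs 0) (nth 0 xs 1) (nth 0 xs 2) (nth 0 xs 3)) ->
  computable k F1 -> computable k F2 -> computable k F3 -> computable k F4 ->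
  computable k (fun i xs => g i (F1 i xs) (F2 i xs) (F3 i xs) (F4 i xs)).
Proof. by move=> cg *; apply: (@computable_comp 4 k _ [:: F1; F2; F3; F4]) cg. Qed.

Lemma computable_oracle k F :
  computable k F -> computable k (fun i xs => o i (F i xs)).
Proof. by apply: computable_call1; exists Oracle => i xs _; constructor. Qed.

Lemma computable_S k F :
  computable k F -> computable k (fun i xs => (F i xs).+1).
Proof.
by apply: (@computable_call1 k (fun _ => S)); exists Succ => i xs _; constructor.
Qed.

Lemma computable_const k m : computable k (fun _ _ => m).
Proof.
elim: m => [|m IH]; last exact: computable_S IH.
by exists Zero => i xs _; constructor.
Qed.

Lemma computable_iteri k N S B :
  computable k N ->
  computable k.+2
    (fun i ys => S i (nth 0 ys 0) (nth 0 ys 1) (behead (behead ys))) ->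
  computable k B ->
  computable k (fun i xs => iteri (N i xs) (fun t z => S i t z xs) (B i xs)).
Proof.
move=> cN [d dP] [b bP].
have cR : computable k.+1 (fun i ys =>
    iteri (nth 0 ys 0) (fun t z => S i t z (behead ys)) (B i (behead ys))).
  exists (PrimRec b d) => i [//|t xs] /= [sz].
  elim: t => [|t IH] /=; first by apply: EvalPrimRec0; apply: bP.
  by apply: EvalPrimRecS IH _; apply: (dP i [:: t, _ & xs]); rewrite /= sz.
(* The recursion runs on the first argument, so it is composed with [N] followed by the [k]
   projections, which copy [xs]. *)
pose Fs := N :: [seq fun (i : I) xs => nth 0 xs j | j <- iota 0 k].
have /computable_ext: computable k (fun i xs =>
    (fun i ys => iteri (nth 0 ys 0) (fun t z => S i t z (behead ys))
       (B i (behead ys))) i [seq F i xs | F <- Fs]).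
  apply: computable_comp cR; first by rewrite /= size_map size_iota.
  split=> //; elim: (iota 0 k) => //= j s IH; split=> //.
  exact: computable_var.
apply=> i xs sz /=; rewrite -map_comp.
rewrite (_ : map _ _ = xs) //; apply: (@eq_from_nth _ 0) => [|j].
  by rewrite size_map size_iota.
rewrite size_map size_iota => ltj.
by rewrite (nth_map 0) ?size_iota // nth_iota.
Qed.

Lemma computable_add k F G : computable k F -> computable k G ->
  computable k (fun i xs => F i xs + G i xs).
Proof.
apply: (@computable_call2 k (fun _ => addn)).
pose F' := fun (i : I) xs => iteri (nth 0 xs 0) (fun _ z => z.+1) (nth 0 xs 1).
apply: (@computable_ext _ F') => [i xs _|].
  by rewrite /F'; elim: (nth 0 xs 0) => //= m ->.
apply: (@computable_iteri _ _ (fun _ _ z _ => z.+1)); try exact: computable_var.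
exact: computable_S (computable_var _ _).
Qed.

Lemma computable_mul k F G : computable k F -> computable k G ->
  computable k (fun i xs => F i xs * G i xs).
Proof.
apply: (@computable_call2 k (fun _ => muln)).
pose F' := fun (i : I) xs => iteri (nth 0 xs 0) (fun _ z => nth 0 xs 1 + z) 0.
apply: (@computable_ext _ F') => [i xs _|].
  by rewrite /F'; elim: (nth 0 xs 0) => //= m ->; rewrite mulSn.
apply: (@computable_iteri _ _ (fun _ _ z xs => nth 0 xs 1 + z)).
- exact: computable_var.
- apply: computable_add; last exact: computable_var.
  by apply: (@computable_ext _ (fun _ xs => nth 0 xs 3)) (computable_var _ _)
    => i xs _; rewrite !nth_behead.
- exact: computable_const.
Qed.

Lemma computable_pred k F : computable k F ->
  computable k (fun i xs => (F i xs).-1).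
Proof.
apply: (@computable_call1 k (fun _ => predn)).
pose F' := fun (i : I) xs => iteri (nth 0 xs 0) (fun t _ => t) 0.
apply: (@computable_ext _ F') => [i xs _|].
  by rewrite /F'; case: (nth 0 xs 0).
apply: (@computable_iteri _ _ (fun _ t _ _ => t)); try exact: computable_var.
exact: computable_const.
Qed.

Lemma computable_sub k F G : computable k F -> computable k G ->
  computable k (fun i xs => F i xs - G i xs).
Proof.
apply: (@computable_call2 k (fun _ => subn)).
pose F' := fun (i : I) xs => iteri (nth 0 xs 1) (fun _ z => z.-1) (nth 0 xs 0).
apply: (@computable_ext _ F') => [i xs _|].
  rewrite /F'; elim: (nth 0 xs 1) => [|m /= ->]; first by rewrite subn0.
  by rewrite subnS.
apply: (@computable_iteri _ _ (fun _ _ z _ => z.-1)); try exact: computable_var.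
exact: computable_pred (computable_var _ _).
Qed.

Lemma computable_leq k F G : computable k F -> computable k G ->
  computable k (fun i xs => F i xs <= G i xs).
Proof.
move=> cF cG; apply: (@computable_ext _ (fun i xs => 1 - (F i xs - G i xs))).
  by move=> i xs _; rewrite /leq; case: (F i xs - G i xs).
by apply: computable_sub; [apply: computable_const|apply: computable_sub].
Qed.

Lemma computable_negb k P : computable k (fun i xs => P i xs : bool) ->
  computable k (fun i xs => ~~ P i xs).
Proof.
move=> cP; apply: (@computable_ext _ (fun i xs => 1 - P i xs)).
  by move=> i xs _; case: (P i xs).
by apply: computable_sub => //; apply: computable_const.
Qed.

Lemma computable_andb k P Q : computable k (fun i xs => P i xs : bool) ->
  computable k (fun i xs => Q i xs : bool) ->
  computable k (fun i xs => P i xs && Q i xs).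
Proof.
move=> cP cQ; apply: (@computable_ext _ (fun i xs => P i xs * Q i xs)).
  by move=> i xs _; rewrite mulnb.
exact: computable_mul.
Qed.

Lemma computable_orb k P Q : computable k (fun i xs => P i xs : bool) ->
  computable k (fun i xs => Q i xs : bool) ->
  computable k (fun i xs => P i xs || Q i xs).
Proof.
move=> cP cQ; apply: (@computable_ext _ (fun i xs => ~~ (~~ P i xs && ~~ Q i xs))).
  by move=> i xs _; rewrite negb_and !negbK.
by apply: computable_negb; apply: computable_andb; apply: computable_negb.
Qed.

Lemma computable_eq k F G : computable k F -> computable k G ->
  computable k (fun i xs => F i xs == G i xs).
Proof.
move=> cF cG.
apply: (@computable_ext _ (fun i xs => (F i xs <= G i xs) && (G i xs <= F i xs))).
  by move=> i xs _; rewrite eqn_leq.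
by apply: computable_andb; apply: computable_leq.
Qed.

Lemma computable_if k P F G : computable k (fun i xs => P i xs : bool) ->
  computable k F -> computable k G ->
  computable k (fun i xs => if P i xs then F i xs else G i xs).
Proof.
move=> cP cF cG.
apply: (@computable_ext _ (fun i xs => P i xs * F i xs + ~~ P i xs * G i xs)).
  by move=> i xs _; case: (P i xs); rewrite ?mul1n ?addn0.
by apply: computable_add; apply: computable_mul => //; apply: computable_negb.
Qed.

Lemma computable_sum k N G : computable k N ->
  computable k.+1 (fun i ys => G i (nth 0 ys 0) (behead ys)) ->
  computable k (fun i xs => \sum_(t < N i xs) G i t xs).
Proof.
move=> cN [g gP].
apply: (@computable_ext _
   (fun i xs => iteri (N i xs) (fun t z => z + G i t xs) 0)) => [i xs _|].
  elim: (N i xs) => [|m /= ->]; first by rewrite big_ord0.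
  by rewrite big_ord_recr.
apply: (@computable_iteri _ _ (fun i t z xs => z + G i t xs)) => //.
  apply: computable_add; first exact: computable_var.
  (* The body of the iteration receives [t], the accumulator and then [xs]; these projections drop
     the accumulator before calling [g]. *)
  exists (Comp g (Proj 0 :: [seq Proj j.+2 | j <- iota 0 k])) => i [//|t [//|z xs]].
  move=> /= [sz]; apply: (@EvalComp _ _ _ _ (t :: xs)); last first.
    by apply: (gP i (t :: xs)); rewrite /= sz.
    move=> [|j] /=; first by constructor.
    rewrite size_map size_iota ltnS => ltj.
    rewrite (nth_map 0) ?size_iota // nth_iota //.
    exact: (@EvalProj _ j.+2 [:: t, z & xs]).
  by rewrite /= size_map size_iota sz.
exact: computable_const.
Qed.

Lemma computable_all k N P : computable k N ->
  computable k.+1 (fun i ys => P i (nth 0 ys 0) (behead ys) : bool) ->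
  computable k (fun i xs => all (fun t => P i t xs) (iota 0 (N i xs))).
Proof.
move=> cN cP.
apply: (@computable_ext _
    (fun i xs => \sum_(t < N i xs) ~~ P i t xs == 0)) => [i xs _|].
  rewrite sum_nat_eq0; congr nat_of_bool; apply/forallP/allP => [H t|H t].
    rewrite mem_iota => /= ltt; have := H (Ordinal ltt).
    by rewrite /= eqb0 negbK.
  by rewrite implyTb eqb0 negbK H // mem_iota add0n ltn_ord.
apply: computable_eq; last exact: computable_const.
by apply: (@computable_sum _ _ (fun i t xs => ~~ P i t xs)) => //; apply: computable_negb.
Qed.

Lemma computable_has k N P : computable k N ->
  computable k.+1 (fun i ys => P i (nth 0 ys 0) (behead ys) : bool) ->
  computable k (fun i xs => has (fun t => P i t xs) (iota 0 (N i xs))).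
Proof.
move=> cN cP.
apply: (@computable_ext _ (fun i xs =>
    ~~ all (fun t => ~~ P i t xs) (iota 0 (N i xs)))) => [i xs _|].
  by rewrite -has_predC; congr nat_of_bool; apply: eq_has => t /=; rewrite negbK.
apply: computable_negb.
by apply: (@computable_all _ _ (fun i t xs => ~~ P i t xs)) => //; apply: computable_negb.
Qed.

(** [Mu] looks for a zero, hence the negation of [P]. A witness has to exist only for the oracles
    indexed by [I], which is how a promise on the input enters. *)
Lemma computable_mu k F P :
  computable k.+1 (fun i ys => P i (nth 0 ys 0) (behead ys) : bool) ->
  (forall i xs, size xs = k ->
     P i (F i xs) xs /\ forall t, P i t xs -> F i xs <= t) ->
  computable k F.
Proof.
move=> /computable_negb[c cP] FP; exists (Mu c) => i xs sz.
have [PF minF] := FP i xs sz.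
(* Below the least witness the negation takes the value 1, the successor of the constant 0. *)
apply: (@EvalMu _ _ _ _ (fun=> 0)) => [t ltt|].
  have /= := cP i (t :: xs); rewrite sz => /(_ erefl).
  by case: (boolP (P i t xs)) => // /minF; rewrite leqNgt ltt.
by have /= := cP i (F i xs :: xs); rewrite sz PF => /(_ erefl).
Qed.

End Computable.

(** * Codes of pairs and lists *)

#[local] Arguments Cantor.to_nat : simpl never.

Definition fst_code m := (Cantor.of_nat m).1.
Definition snd_code m := (Cantor.of_nat m).2.
Definition component i m := fst_code (iter i snd_code m).
Definition encode := foldr (fun x m => Cantor.to_nat (x, m)) 0.

Lemma fst_code_pair x y : fst_code (Cantor.to_nat (x, y)) = x.
Proof. by rewrite /fst_code Cantor.cancel_of_to. Qed.

Lemma snd_code_pair x y : snd_code (Cantor.to_nat (x, y)) = y.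
Proof. by rewrite /snd_code Cantor.cancel_of_to. Qed.

Lemma pair_codeK m : Cantor.to_nat (fst_code m, snd_code m) = m.
Proof. by rewrite -surjective_pairing Cantor.cancel_to_of. Qed.

Lemma code_add_le m : fst_code m + snd_code m <= m.
Proof.
rewrite -{3}(pair_codeK m) addnC; apply/ssrnat.leP.
exact: Cantor.to_nat_non_decreasing.
Qed.

(** Past the end of the list both sides are 0, because 0 codes the pair of zeros. *)
Lemma component_encode i l : component i (encode l) = nth 0 l i.
Proof.
rewrite /component; elim: i l => [|i IH] [|x l].
- by [].
- exact: fst_code_pair.
- by rewrite iterSr (IH [::]) !nth_nil.
- by rewrite iterSr snd_code_pair IH.
Qed.

(** Through this bound a stage controls all numerators and denominators carried by the codes seen so
    far. *)
Lemma component_le i m : component i m <= m.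
Proof.
rewrite /component; elim: i m => [|i IH] m.
  exact: leq_trans (leq_addr _ _) (code_add_le m).
by rewrite iterSr; apply: leq_trans (IH _) (leq_trans (leq_addl _ _) (code_add_le m)).
Qed.

Section ComputableCodes.

Variables (I : Type) (o : I -> baire).
Local Notation computable := (computable o).

Lemma computable_var1 k j : computable k (fun _ xs => nth 0 (behead xs) j).
Proof.
by apply: computable_ext (computable_var _ _ j.+1) => i xs _; rewrite nth_behead.
Qed.

Lemma computable_var2 k j : computable k (fun _ xs => nth 0 (behead (behead xs)) j).
Proof.
by apply: computable_ext (computable_var1 _ j.+1) => i xs _; rewrite !nth_behead.
Qed.

Lemma computable_var3 k j :
  computable k (fun _ xs => nth 0 (behead (behead (behead xs))) j).
Proof.
by apply: computable_ext (computable_var2 _ j.+1) => i xs _; rewrite !nth_behead.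
Qed.

Lemma computable_pair k F G : computable k F -> computable k G ->
  computable k (fun i xs => Cantor.to_nat (F i xs, G i xs)).
Proof.
move=> cF cG; apply: (computable_call2 (g := fun _ x y => Cantor.to_nat (x, y))) cF cG.
(* Cantor's formula: the second entry plus the triangular number of the sum of both entries. *)
apply: (@computable_ext _ _ _ (fun _ xs => nth 0 xs 1 +
   iteri (nth 0 xs 1 + nth 0 xs 0) (fun t z => t.+1 + z) 0)) => //.
apply: computable_add; first exact: computable_var.
apply: (@computable_iteri _ _ _ _ (fun _ t z _ => t.+1 + z)).
- by apply: computable_add; apply: computable_var.
- by apply: computable_add; [apply: computable_S|]; apply: computable_var.
- exact: computable_const.
Qed.

(** At most one summand survives, since pairing is injective, and it lies within the bounds, since
    both components of [m] are at most [m]. Decoding thus becomes a bounded sum, with no need to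
    compute the inverse of the pairing directly. *)
Lemma sum_code_eq (G : nat -> nat -> nat) m :
  \sum_(x < m.+1) \sum_(y < m.+1)
     (if Cantor.to_nat (x : nat, y : nat) == m then G x y else 0)
  = G (fst_code m) (snd_code m).
Proof.
have le1 : fst_code m < m.+1 by exact: leq_trans (leq_addr _ _) (code_add_le m).
have le2 : snd_code m < m.+1 by exact: leq_trans (leq_addl _ _) (code_add_le m).
rewrite (bigD1 (Ordinal le1)) //= (bigD1 (Ordinal le2)) //= pair_codeK eqxx.
rewrite !big1 ?addn0 // => [x /eqP nx|y /eqP ny]; last first.
  case: eqP => // e; case: ny; apply: val_inj => /=.
  by move: (congr1 snd_code e); rewrite snd_code_pair.
rewrite big1 // => y _; case: eqP => // e; case: nx; apply: val_inj => /=.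
by move: (congr1 fst_code e); rewrite fst_code_pair.
Qed.

Lemma computable_of_sum (G : nat -> nat -> nat) k F :
  computable 2 (fun _ xs => G (nth 0 xs 0) (nth 0 xs 1)) -> computable k F ->
  computable k (fun i xs => G (fst_code (F i xs)) (snd_code (F i xs))).
Proof.
move=> cG; apply: (computable_call1 (g := fun _ m => G (fst_code m) (snd_code m))).
apply: computable_ext => [i xs _|]; first exact: sum_code_eq.
apply: (@computable_sum _ _ _ (fun _ xs => (nth 0 xs 0).+1) (fun _ x xs =>
   \sum_(y < (nth 0 xs 0).+1)
   if Cantor.to_nat (x, y : nat) == nth 0 xs 0 then G x y else 0)).
  exact: computable_S (computable_var _ _ _).
apply: (@computable_sum _ _ _ (fun _ xs => (nth 0 (behead xs) 0).+1) (fun _ y xs =>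
   if Cantor.to_nat (nth 0 xs 0, y) == nth 0 (behead xs) 0
   then G (nth 0 xs 0) y else 0)).
  exact: computable_S (computable_var1 _ _).
apply: computable_if; last exact: computable_const.
  apply: computable_eq; last exact: computable_var2.
  by apply: computable_pair; [apply: computable_var1|apply: computable_var].
by apply: (computable_call2 (g := fun _ => G)) cG _ _;
  [apply: computable_var1|apply: computable_var].
Qed.

Lemma computable_fst_code k F :
  computable k F -> computable k (fun i xs => fst_code (F i xs)).
Proof. by apply: (@computable_of_sum (fun x _ => x)); apply: computable_var. Qed.

Lemma computable_snd_code k F :
  computable k F -> computable k (fun i xs => snd_code (F i xs)).
Proof. by apply: (@computable_of_sum (fun _ y => y)); apply: computable_var. Qed.

Lemma computable_component k F G : computable k F -> computable k G ->
  computable k (fun i xs => component (F i xs) (G i xs)).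
Proof.
apply: (computable_call2 (g := fun _ => component)).
apply: (@computable_fst_code _ (fun _ xs => iter (nth 0 xs 0) snd_code (nth 0 xs 1))).
apply: (@computable_ext _ _ _ (fun _ xs =>
   iteri (nth 0 xs 0) (fun _ => snd_code) (nth 0 xs 1))) => [i xs _|].
  by elim: (nth 0 xs 0) => //= m ->.
apply: (@computable_iteri _ _ _ _ (fun _ _ z _ => snd_code z)).
- exact: computable_var.
- exact: computable_snd_code (computable_var _ _ _).
- exact: computable_var.
Qed.

Lemma computable_column k a F : computable k F ->
  computable k (fun i xs => column (o i) a (F i xs)).
Proof.
by move=> cF; apply: computable_oracle; apply: computable_pair => //;
  apply: computable_const.
Qed.

Lemma computable_op2_column k a F G : computable k F -> computable k G ->
  computable k (fun i xs => op2 (column (o i) a) (F i xs) (G i xs)).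
Proof. by move=> cF cG; apply: computable_column; apply: computable_pair. Qed.

End ComputableCodes.

Ltac computability :=
  cbv beta; try eassumption;
  lazymatch goal with
  | |- computable _ _ (fun i xs => nth 0 xs _) => exact: computable_var
  | |- computable _ _ (fun i xs => nth 0 (behead xs) _) => exact: computable_var1
  | |- computable _ _ (fun i xs => nth 0 (behead (behead xs)) _) =>
      exact: computable_var2
  | |- computable _ _ (fun i xs => nth 0 (behead (behead (behead xs))) _) =>
      exact: computable_var3
  | |- computable _ _ (fun i xs => (@?F i xs).+1) =>
      apply: (computable_S (F := F)); computability
  | |- computable _ _ (fun i xs => (@?F i xs).-1) =>
      apply: (computable_pred (F := F)); computability
  | |- computable _ _ (fun i xs => addn (@?F i xs) (@?G i xs)) =>
      apply: (computable_add (F := F) (G := G)); computability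
  | |- computable _ _ (fun i xs => muln (@?F i xs) (@?G i xs)) =>
      apply: (computable_mul (F := F) (G := G)); computability
  | |- computable _ _ (fun i xs => subn (@?F i xs) (@?G i xs)) =>
      apply: (computable_sub (F := F) (G := G)); computability
  | |- computable _ _ (fun i xs => nat_of_bool (leq (@?F i xs) (@?G i xs))) =>
      apply: (computable_leq (F := F) (G := G)); computability
  | |- computable _ _ (fun i xs => nat_of_bool (@?F i xs == @?G i xs)) =>
      apply: (computable_eq (F := F) (G := G)); computability
  | |- computable _ _ (fun i xs => nat_of_bool (~~ @?P i xs)) =>
      apply: (computable_negb (P := P)); computability
  | |- computable _ _ (fun i xs => nat_of_bool (@?P i xs && @?Q i xs)) =>
      apply: (computable_andb (P := P) (Q := Q)); computability
  | |- computable _ _ (fun i xs => nat_of_bool (@?P i xs || @?Q i xs)) =>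
      apply: (computable_orb (P := P) (Q := Q)); computability
  | |- computable _ _ (fun i xs => nat_of_bool (all _ (iota 0 _))) =>
      apply: computable_all; computability
  | |- computable _ _ (fun i xs => nat_of_bool (has _ (iota 0 _))) =>
      apply: computable_has; computability
  | |- computable _ _ (fun i xs => iteri _ _ _) =>
      apply: computable_iteri; computability
  | |- computable _ _ (fun i xs => if _ then _ else _) =>
      apply: computable_if; computability
  | |- computable _ _ (fun i xs => Cantor.to_nat (@?F i xs, @?G i xs)) =>
      apply: (computable_pair (F := F) (G := G)); computability
  | |- computable _ _ (fun i xs => fst_code (@?F i xs)) =>
      apply: (computable_fst_code (F := F)); computability
  | |- computable _ _ (fun i xs => snd_code (@?F i xs)) =>
      apply: (computable_snd_code (F := F)); computability
  | |- computable _ _ (fun i xs => component (@?F i xs) (@?G i xs)) =>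
      apply: (computable_component (F := F) (G := G)); computability
  | |- computable _ _ (fun i xs => op2 (column _ ?a) (@?F i xs) (@?G i xs)) =>
      apply: (@computable_op2_column _ _ _ a F G); computability
  | |- computable _ _ (fun i xs => column _ ?a (@?F i xs)) =>
      apply: (@computable_column _ _ _ a F); computability
  | |- _ => try exact: computable_const
  end.

(** * Finding a basis with C_N *)

Definition lincomb (p : baire) t w m :=
  iteri m (fun i z => op2 (column p 6)
    (op2 (column p 7) (component i w) (component i t)) z) (column p 8 0).

(** Here [t] codes the tuple and [w] the coefficients of a suspected relation. Spanning is not
    tested: in dimension [n] an independent [n]-tuple is a basis. *)
Definition not_basis (p : baire) n t w :=
  has (fun i => column p 5 (component i t) == 0) (iota 0 n) ||
  (all (fun i => column p 0 (component i w) == 1) (iota 0 n) &&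
   (has (fun i => component i w != column p 3 0) (iota 0 n) &&
    (lincomb p t w n == column p 8 0))).

(** The value 0 is reserved for pairs refuting nothing, so that the candidate
    basis [t] is represented by [t.+1]. *)
Definition refuted (p : baire) n m :=
  if not_basis p n (fst_code m) (snd_code m) then (fst_code m).+1 else 0.

Lemma computable_refuted n :
  computable (@id baire) 1 (fun p xs => refuted p n (nth 0 xs 0)).
Proof.
rewrite /refuted /not_basis /lincomb; computability.
Qed.

Section CodedSpace.

Variables (p : baire) (K : fieldType) (V : vectType K).
Variables (cK : K -> nat) (cV : V -> nat).
Hypothesis pKV : codes_space p cK cV.

Lemma column_vec k : (column p 5 k != 0) <-> exists v, cV v = k.
Proof. by case: pKV => _ [_ /(_ k)] [[? ->]|[? ->]] //. Qed.

Lemma column_scalar k : (column p 0 k == 1) <-> exists a, cK a = k.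
Proof. by case: pKV => [[_ /(_ k)]] [[? ->]|[? ->]]. Qed.

Lemma lincombE t w m (a : nat -> K) (v : nat -> V) :
  (forall i, i < m -> component i w = cK (a i)) ->
  (forall i, i < m -> component i t = cV (v i)) ->
  lincomb p t w m = cV (\sum_(i < m) a i *: v i)%R.
Proof.
case: pKV => _ [_ _ addV scaleV zeroV].
rewrite /lincomb; elim: m => [|m IH] wE tE; first by rewrite big_ord0 zeroV.
rewrite big_ord_recr /= IH => [|i lti|i lti]; try by rewrite (wE, tE) // ltnW.
by rewrite wE // tE // scaleV addV addrC.
Qed.

Lemma scalar_codes w m : all (fun i => column p 0 (component i w) == 1) (iota 0 m) ->
  exists a : nat -> K, forall i, i < m -> component i w = cK (a i).
Proof.
move=> /allP wK.
have /fin_all_exists[a aE] : forall i : 'I_m, exists a, cK a = component i w.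
  by move=> i; apply/column_scalar/wK; rewrite mem_iota /= add0n.
by exists (fun i => if insub i is Some j then a j else 0%R) => i lti; rewrite insubT aE.
Qed.

Lemma basis_not_refuted n t w (b : n.-tuple V) : basis_of fullv b ->
  (forall i : 'I_n, component i t = cV b`_i) -> ~~ not_basis p n t w.
Proof.
case: (pKV) => [[_ _ _ _ [zeroK _]] [injV _ _ _ zeroV]] bB bE.
rewrite negb_or; apply/andP; split.
  apply/hasPn=> i; rewrite mem_iota => /= lti.
  by apply/column_vec; exists (b`_i)%R; rewrite -(bE (Ordinal lti)).
apply/and3P=> -[/scalar_codes[a aE] /hasP[i0]].
rewrite mem_iota => /= lti0 nz /eqP.
rewrite (lincombE aE (fun i lti => bE (Ordinal lti))) zeroV => /injV lin0.
have /freeP/(_ (fun i => a i) lin0 (Ordinal lti0)) a0 := basis_free bB.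
by move: nz; rewrite aE // a0 zeroK eqxx.
Qed.

Lemma not_refuted_basis n t : \dim {:V} = n -> (forall w, ~~ not_basis p n t w) ->
  exists2 b : n.-tuple V, basis_of fullv b &
    forall i : 'I_n, component i t = cV b`_i.
Proof.
case: (pKV) => [[injK _ _ _ [zeroK _]] [injV _ _ _ zeroV]] dimV tB.
have /fin_all_exists[v vE] : forall i : 'I_n, exists v, cV v = component i t.
  (* Membership in the universe does not depend on [w], so any value, such as 0, will do. *)
  move=> i; apply/column_vec; have := tB 0; rewrite negb_or => /andP[/hasPn tV _].
  by apply: tV; rewrite mem_iota /= add0n.
exists [tuple v i | i < n]; last by move=> i; rewrite -tnth_nth tnth_mktuple vE.
rewrite basisEfree subvf size_tuple dimV leqnn !andbT.
apply/freeP => a lin0 i; apply: contraTeq isT => ai_nz.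
(* The coefficients of a nontrivial relation, coded as [w], would refute [t]. *)
pose w := encode [seq cK (a j) | j : 'I_n].
have wE (j : 'I_n) : component j w = cK (a j).
  rewrite component_encode (nth_map j) ?size_enum_ord // nth_ord_enum //.
suff : not_basis p n t w by rewrite (negPf (tB w)).
pose a' j := if insub j is Some j' then a j' else 0%R.
pose v' j := if insub j is Some j' then v j' else 0%R.
have a'E (j : 'I_n) : a' j = a j by rewrite /a' valK.
have v'E (j : 'I_n) : v' j = v j by rewrite /v' valK.
apply/orP; right; apply/and3P; split.
- apply/allP => j; rewrite mem_iota => /= ltj.
  by apply/column_scalar; exists (a (Ordinal ltj)); rewrite -wE.
- apply/hasP; exists (i : nat); first by rewrite mem_iota /= add0n.
  by rewrite wE zeroK (inj_eq injK).
- rewrite (@lincombE _ _ _ a' v') => [|j ltj|j ltj].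
  + rewrite zeroV (inj_eq injV) -[X in _ == X]lin0; apply/eqP/eq_bigr => j _.
    by rewrite a'E v'E -tnth_nth tnth_mktuple.
  + by rewrite -[j]/(val (Ordinal ltj)) wE a'E.
  + by rewrite -[j]/(val (Ordinal ltj)) -vE v'E.
Qed.

End CodedSpace.

Definition tuple_set n m k := has (fun i => component i m.-1 == k) (iota 0 n).

Lemma VSB_le_C_N n : sW_le (VSB n) C_N.
Proof.
have [Phi PhiP] := computable_refuted n.
have [Psi PsiP] : computable (@id baire) 1
    (fun R xs => tuple_set n (R 0) (nth 0 xs 0)).
  rewrite /tuple_set; computability.
  by apply: (@computable_oracle _ id _ (fun _ _ => 0)); computability.
exists Phi, Psi => p [K [V [cK [cV [pKV dimV]]]]].
exists (refuted p n); split.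
- by move=> k; apply: (PhiP p [:: k]).
- have bB := vbasisP {:V}; move: (vbasis _) bB; rewrite dimV => b bB.
  (* A basis exists and is never refuted, so the successor of its code is outside the range. *)
  pose t := encode (map cV b); exists t.+1 => m; rewrite /refuted.
  case: ifP => // + [tE]; rewrite tE; apply/negP.
  apply: (basis_not_refuted pKV _ bB) => i.
  by rewrite component_encode (nth_map 0%R) ?size_tuple.
move=> R /= nR; exists (tuple_set n (R 0)); split.
  by move=> k; apply: (PsiP R [:: k]).
(* The value 0 is taken: a pair whose first entry codes a basis refutes nothing. Hence the answer
   [R 0] is a successor. *)
have [t Rt] : exists t, R 0 = t.+1.
  exists (R 0).-1; rewrite prednK // lt0n; apply/eqP => R0.
  have bB := vbasisP {:V}; move: (vbasis _) bB; rewrite dimV => b bB.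
  pose t := encode (map cV b); apply: (nR (Cantor.to_nat (t, 0))).
  rewrite /refuted fst_code_pair ifN ?R0 //.
  apply: (basis_not_refuted pKV _ bB) => i.
  by rewrite component_encode (nth_map 0%R) ?size_tuple.
have [w|b bB bE] := @not_refuted_basis _ _ _ _ _ pKV n t dimV.
  apply/negP => tw; apply: (nR (Cantor.to_nat (t, w))).
  by rewrite /refuted fst_code_pair snd_code_pair tw Rt.
exists K, V, cK, cV; split=> //; exists b => // k.
rewrite /tuple_set Rt /=; case: hasP => tk; [left|right]; split=> //.
  case: tk => i; rewrite mem_iota => /= lti /eqP <-.
  exists (b`_i)%R; first by rewrite mem_nth ?size_tuple.
  by rewrite -(bE (Ordinal lti)).
case=> v /(nthP 0%R)[i]; rewrite size_tuple => lti <- ck; case: tk; exists i.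
  by rewrite mem_iota.
by rewrite -ck -(bE (Ordinal lti)).
Qed.

(** * Stages of the presentation of Q^n *)

Section Candidate.

Variable f : baire.

(** Every stage searches all arguments up to [t] afresh, so a value of [f] that occurred before it
    became the candidate is not missed. *)
Definition candidate s :=
  iteri s (fun t z => z + has (fun i => f i == z) (iota 0 t.+1)) 0.

Lemma candidateS s : candidate s.+1 =
  candidate s + has (fun i => f i == candidate s) (iota 0 s.+1).
Proof. by []. Qed.

Lemma candidate_mono s s' : s <= s' -> candidate s <= candidate s'.
Proof.
move=> /subnKC <-; elim: (s' - s) => [|d IH]; first by rewrite addn0.
by rewrite addnS candidateS (leq_trans IH) ?leq_addr.
Qed.

Lemma candidate_le m s : (forall k, f k <> m) -> candidate s <= m.
Proof.
move=> mP; elim: s => [|s IH] //; rewrite candidateS.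
case: hasP => [[i _ /eqP fi]|_]; last by rewrite addn0.
by rewrite addn1 ltn_neqAle IH andbT -fi; apply/eqP/mP.
Qed.

(** The candidate is monotone and bounded by any number outside the range; the induction is on the
    remaining gap. The stage is obtained classically and serves only the verification, not the
    reduction. *)
Lemma candidate_stable : (exists m, forall k, f k <> m) ->
  exists S, forall s, S <= s -> candidate s = candidate S.
Proof.
case=> m mP; suff: forall d S, m - candidate S <= d ->
    exists S, forall s, S <= s -> candidate s = candidate S by move/(_ m 0); apply; lia.
elim=> [|d IH] S Sd.
  exists S => s leSs; apply/eqP; rewrite eqn_leq (candidate_mono leSs) andbT.
  by apply: leq_trans (candidate_le s mP) _; rewrite -subn_eq0 -leqn0.
case: (Classical_Prop.classic (exists2 s, S <= s & candidate s <> candidate S)).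
  case=> s leSs ne; apply: (IH s); have := candidate_mono leSs.
  have := candidate_le s mP; lia.
move=> noS; exists S => s leSs; apply/eqP/negPn/negP => /eqP ne.
by apply: noS; exists s.
Qed.

Lemma candidate_stable_notin S :
  (forall s, S <= s -> candidate s = candidate S) ->
  forall k, f k <> candidate S.
Proof.
(* The search made at stage [maxn S k] includes [k] and would still increase the candidate. *)
move=> stS k fk; have := stS (maxn S k).+1 (leqW (leq_maxl _ _)).
rewrite candidateS (stS _ (leq_maxl _ _)).
case: hasP => [_|[]]; first by lia.
by exists k; [rewrite mem_iota /=; lia|apply/eqP].
Qed.

End Candidate.

(** These are the collapse factors. A relation in coordinate 0 at stage [s] consists of three terms
    of size at most [s.+1 ^ 4 * (growth s).+1]; the factor 4 puts the next value strictly above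
    their sum. *)
Definition growth s := iteri s (fun t z => 4 * (t.+1 ^ 4 * z.+1)) 1.

Lemma growthS s : growth s.+1 = 4 * (s.+1 ^ 4 * (growth s).+1).
Proof. by []. Qed.

Lemma growth_mono s s' : s <= s' -> growth s <= growth s'.
Proof.
move=> /subnKC <-; elim: (s' - s) => [|d IH]; first by rewrite addn0.
rewrite addnS growthS; apply: leq_trans IH _; move: (growth _) => g.
rewrite mulnCA -[X in X <= _]mul1n leq_mul ?expn_gt0 //; lia.
Qed.

(** When [g] has been refuted by stage [s], this is the stage of its refutation. *)
Definition collapse_stage f g s := \sum_(t < s) (candidate f t <= g : nat).

Lemma collapse_stage_le f g s : collapse_stage f g s <= s.
Proof.
rewrite -[X in _ <= X]card_ord -sum1_card.
by apply: leq_sum => i _; apply: leq_b1.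
Qed.

Definition denominator k := (component 1 k).+1.

(** Coordinate [i] of the vector coded by [k], as seen at stage [s], is the
    difference of the numerators with [off = 2] and [off = 3] over
    [denominator k].  Component 0 of [k] is its claim; a claim which is too
    large when [k] is reached turns [k] into a code of the zero vector. *)
Definition numerator f s i off k :=
  if candidate f k < component 0 k then 0 else
  if component 0 k < candidate f s then
    if i == 0 then component off k +
      growth (collapse_stage f (component 0 k) s) * component off.+2 k
    else if i == 1 then 0 else component (i * 2 + off) k
  else component (i * 2 + off) k.

(** [(xj - yj) / dj = (xc - yc) / dc * ((xk - yk) / dk) + (xl - yl) / dl],
    with denominators cleared and negative terms moved to the other side. *)
Definition lin_eq (xc yc dc xk yk dk xl yl dl xj yj dj : nat) : bool :=
  xj * (dc * dk * dl) + ((xc * yk + yc * xk) * (dl * dj) + yl * (dc * dk * dj)) ==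
  yj * (dc * dk * dl) + ((xc * xk + yc * yk) * (dl * dj) + xl * (dc * dk * dj)).

(** One relation covers both operations: the scalar 1 for [c] gives addition, and 0 for [l] gives
    multiplication. A single stability argument then suffices. *)
Definition field_rel c k l j :=
  lin_eq (component 2 c) (component 3 c) (denominator c)
    (component 2 k) (component 3 k) (denominator k)
    (component 2 l) (component 3 l) (denominator l)
    (component 2 j) (component 3 j) (denominator j).

Definition space_rel_at f n s c k l j :=
  all (fun i => lin_eq (component 2 c) (component 3 c) (denominator c)
    (numerator f s i 2 k) (numerator f s i 3 k) (denominator k)
    (numerator f s i 2 l) (numerator f s i 3 l) (denominator l)
    (numerator f s i 2 j) (numerator f s i 3 j) (denominator j)) (iota 0 n).

(** The sum is a computable stage not below any of the four codes; from there on the relation no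
    longer changes. *)
Definition space_rel f n c k l j := space_rel_at f n (c + k + l + j) c k l j.

(** * Stability of relations under refutations *)

Section Stability.

Variable f : baire.

Lemma numerator_const s i off k :
  candidate f s.+1 = candidate f s ->
  numerator f s.+1 i off k = numerator f s i off k.
Proof.
rewrite /numerator => ->; case: ifP => // _; case: ltnP => // dead.
(* A claim already refuted at stage [s] does not count [s], so its collapse factor is frozen. *)
rewrite /collapse_stage big_ord_recr /= [candidate f s <= _]leqNgt dead addn0.
by [].
Qed.

(** A refutation acts on all codes up to [s] by one linear map. A valid live claim of such a code
    must be exactly [candidate f s], and codes with a dead or invalid claim have coordinate 1 equal
    to 0 already. Codes beyond [s] may claim the new candidate, hence [k <= s]. *)
Lemma numerator_collapse s i off k : k <= s ->
  candidate f s.+1 <> candidate f s ->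
  numerator f s.+1 i off k =
    if i == 0 then numerator f s 0 off k + growth s.+1 * numerator f s 1 off k
    else if i == 1 then 0 else numerator f s i off k.
Proof.
move=> leks neq; have {neq} cS : candidate f s.+1 = (candidate f s).+1.
  by move: neq; rewrite candidateS; case: has; rewrite ?addn0 ?addn1.
rewrite /numerator cS ltnS.
case: ltnP => [_|valid]; first by case: ifP => _; [rewrite muln0|case: ifP].
rewrite (leq_trans valid (candidate_mono _ leks)) /=.
case: ltnP => [dead|alive].
  rewrite /collapse_stage big_ord_recr /= [candidate f s <= _]leqNgt dead addn0.
  by case: i => [|[|i]] //=; rewrite muln0 addn0.
(* All candidates up to stage [s] are at most the claim, so the count is [s.+1]. *)
case: i => [|[|i]] //=; rewrite (_ : collapse_stage _ _ _ = s.+1) ?add0n //.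
rewrite /collapse_stage (eq_bigr (fun=> 1)) ?sum1_card ?card_ord // => t _.
by rewrite (leq_trans (candidate_mono _ _) alive) // -ltnS.
Qed.

Lemma numerator0_le s off k : k <= s ->
  numerator f s 0 off k <= s * (growth s).+1.
Proof.
move=> leks; rewrite /numerator; case: ifP => // _.
have leC i : component i k <= s by apply: leq_trans (component_le _ _) leks.
case: ifP => //= _; last exact: leq_trans (leC _) (leq_pmulr _ _).
rewrite mulnS leq_add // mulnC leq_mul //.
exact: growth_mono (collapse_stage_le _ _ _).
Qed.

End Stability.

Local Open Scope ring_scope.

Lemma lin_eqE xc yc dc xk yk dk xl yl dl xj yj dj :
  lin_eq xc yc dc xk yk dk xl yl dl xj yj dj =
  ((xj%:Z - yj%:Z) * (dc%:Z * dk%:Z * dl%:Z)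
   - (xc%:Z - yc%:Z) * (xk%:Z - yk%:Z) * (dl%:Z * dj%:Z)
   - (xl%:Z - yl%:Z) * (dc%:Z * dk%:Z * dj%:Z) == 0).
Proof.
rewrite /lin_eq -eqz_nat !PoszD !PoszM -subr_eq0; congr (_ == 0).
by rewrite !PoszD !PoszM; ring.
Qed.

(* [g] bounds the old collapse factors and [q] is the new one: the integer
   combination of the 0th coordinates is smaller than [q]. *)
Lemma lin_eq_collapse (s g q xc yc dc dk dl dj : nat) (x0 y0 x1 y1 : nat -> nat) k l j :
  (xc <= s)%N -> (yc <= s)%N -> (dc <= s.+1)%N -> (dk <= s.+1)%N ->
  (dl <= s.+1)%N -> (dj <= s.+1)%N ->
  (forall m, m \in [:: k; l; j] -> x0 m <= s * g.+1)%N ->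
  (forall m, m \in [:: k; l; j] -> y0 m <= s * g.+1)%N ->
  q = (4 * (s.+1 ^ 4 * g.+1))%N ->
  lin_eq xc yc dc (x0 k + q * x1 k) (y0 k + q * y1 k) dk
    (x0 l + q * x1 l) (y0 l + q * y1 l) dl (x0 j + q * x1 j) (y0 j + q * y1 j) dj =
  lin_eq xc yc dc (x0 k) (y0 k) dk (x0 l) (y0 l) dl (x0 j) (y0 j) dj &&
  lin_eq xc yc dc (x1 k) (y1 k) dk (x1 l) (y1 l) dl (x1 j) (y1 j) dj.
Proof.
have tri (a b c B : int) : 0 < B -> `|a| <= B -> `|b| <= B -> `|c| <= B ->
  `|a - b - c| < B + B + B + B by lia.
have dist (x y b : nat) : (x <= b)%N -> (y <= b)%N -> `|x%:Z - y%:Z| <= b%:Z by lia.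
move=> xcs ycs dcs dks dls djs x0s y0s qE; rewrite !lin_eqE.
set W0 := (X in _ = (X == 0) && _); set W1 := (X in _ = _ && (X == 0)).
set W := (X in (X == 0) = _); have -> : W = W0 + q%:Z * W1.
  by rewrite /W /W0 /W1 !PoszD !PoszM; ring.
(* Each of the three terms of [W0] is bounded by four factors [s.+1] and one factor [g.+1], the
   difference of numerators contributing one of each; [q] is four times this product. *)
have W0q : `|W0| < q%:Z.
  pose B : int := s.+1%:Z ^+ 4 * g.+1%:Z.
  have bnd m : m \in [:: k; l; j] -> `|(x0 m)%:Z - (y0 m)%:Z| <= s.+1%:Z * g.+1%:Z.
    move=> mP; apply: le_trans (dist _ _ _ (x0s m mP) (y0s m mP)) _.
    by rewrite -PoszM lez_nat leq_mul.
  have bc : `|xc%:Z - yc%:Z| <= s.+1%:Z by apply: dist; exact: leqW.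
  have abs (d : nat) : `|d%:Z| = d%:Z by [].
  have := bnd k; have := bnd l; have := bnd j; rewrite !inE !eqxx !orbT.
  move=> /(_ isT) bj /(_ isT) bl /(_ isT) bk.
  have BE : B = (s.+1%:Z * g.+1%:Z) * (s.+1%:Z * s.+1%:Z * s.+1%:Z).
    by rewrite /B; ring.
  have h1 : `|((x0 j)%:Z - (y0 j)%:Z) * (dc%:Z * dk%:Z * dl%:Z)| <= B.
    rewrite !normrM !abs BE.
    by rewrite !ler_pM ?mulr_ge0 // lez_nat.
  have h2 : `|(xc%:Z - yc%:Z) * ((x0 k)%:Z - (y0 k)%:Z) * (dl%:Z * dj%:Z)| <= B.
    rewrite !normrM !abs (_ : B = s.+1%:Z * (s.+1%:Z * g.+1%:Z) *
      (s.+1%:Z * s.+1%:Z)); last by rewrite /B; ring.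
    by rewrite !ler_pM ?mulr_ge0 // lez_nat.
  have h3 : `|((x0 l)%:Z - (y0 l)%:Z) * (dc%:Z * dk%:Z * dj%:Z)| <= B.
    rewrite !normrM !abs BE.
    by rewrite !ler_pM ?mulr_ge0 // lez_nat.
  have B0 : 0 < B by rewrite mulr_gt0 // exprn_gt0.
  rewrite (_ : q%:Z = 4 * B); last by rewrite qE !PoszM /B; ring.
  have -> : 4 * B = B + B + B + B by ring.
  exact: tri B0 h1 h2 h3.
(* A nonzero integer [W1] makes [q * W1] at least [q] in absolute value, so [W0] cannot cancel
   it. *)
have [->|W1n] := eqVneq W1 0; first by rewrite mulr0 addr0 andbT.
rewrite andbF; apply/negP; rewrite addr_eq0 => /eqP W0E.
move: W0q; rewrite W0E normrN normrM ltNge ler_peMr //.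
by rewrite -gtz0_ge1 normr_gt0.
Qed.

Local Open Scope nat_scope.

(** By [lin_eq_collapse], the equation in coordinate 0 after a refutation is equivalent to the old
    equations in coordinates 0 and 1 together. No information is lost, and the other coordinates
    stay as they were. *)
Lemma space_rel_at_step f n s c k l j : 1 < n ->
  c <= s -> k <= s -> l <= s -> j <= s ->
  space_rel_at f n s.+1 c k l j = space_rel_at f n s c k l j.
Proof.
move=> n_gt1 lecs leks lels lejs; rewrite /space_rel_at.
have [cS|/eqP cS] := eqVneq (candidate f s.+1) (candidate f s).
  by apply: eq_all => i; rewrite !numerator_const.
under eq_all => i do rewrite !(numerator_collapse _ _ _ cS) //.
case: n n_gt1 => [|[|n]] // _; rewrite -[n.+2]/(2 + n) iotaD !all_cat /= !andbT.
have le_den m : m <= s -> denominator m <= s.+1.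
  by move=> lems; rewrite ltnS (leq_trans (component_le _ _)).
have le_num (off m : nat) : m \in [:: k; l; j] ->
    numerator f s 0 off m <= s * (growth s).+1.
  by rewrite !inE => /or3P[] /eqP ->; apply: numerator0_le.
rewrite (@lin_eq_collapse s (growth s) _ _ _ _ _ _ _ (numerator f s 0 2)
  (numerator f s 0 3) (numerator f s 1 2) (numerator f s 1 3))
  ?le_den ?growthS //; first last.
- by move=> m /(le_num 3).
- by move=> m /(le_num 2).
- exact: leq_trans (component_le _ _) lecs.
- exact: leq_trans (component_le _ _) lecs.
(* The new equation in coordinate 1 reads 0 = 0. *)
rewrite {3}/lin_eq !muln0 !mul0n addn0 eqxx -andbA; congr (_ && (_ && _)).
apply: eq_in_all => i; rewrite mem_iota => /andP[i_ge2 _].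
by case: i i_ge2 => [|[|i]].
Qed.

Lemma space_rel_at_stable f n s c k l j : 1 < n ->
  c + k + l + j <= s -> space_rel_at f n s c k l j = space_rel f n c k l j.
Proof.
move=> n_gt1 /subnKC <-; elim: (_ - _) => [|d IH]; first by rewrite addn0.
by rewrite addnS space_rel_at_step ?IH //; lia.
Qed.

Lemma numerator_stable f S s i off k :
  (forall s, S <= s -> candidate f s = candidate f S) -> S <= s ->
  numerator f s i off k = numerator f S i off k.
Proof.
move=> stS /subnKC <-; elim: (s - S) => [|d IH]; first by rewrite addn0.
by rewrite addnS numerator_const ?IH // !stS //; lia.
Qed.

(** * Rational values of the codes *)

Local Open Scope ring_scope.

Definition fraction (x y d : nat) : rat := (x%:R - y%:R) / d%:R.

Lemma lin_eq_fraction xc yc dc xk yk dk xl yl dl xj yj dj :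
  (0 < dc)%N -> (0 < dk)%N -> (0 < dl)%N -> (0 < dj)%N ->
  lin_eq xc yc dc xk yk dk xl yl dl xj yj dj =
  (fraction xj yj dj ==
     fraction xc yc dc * fraction xk yk dk + fraction xl yl dl).
Proof.
rewrite -!(ltr0n rat) => dc0 dk0 dl0 dj0; rewrite /fraction -subr_eq0.
set z := (X in _ = (X == 0)).
have -> : z = ((xj%:R - yj%:R) * (dc%:R * dk%:R * dl%:R)
   - (xc%:R - yc%:R) * (xk%:R - yk%:R) * (dl%:R * dj%:R)
   - (xl%:R - yl%:R) * (dc%:R * dk%:R * dj%:R)) / (dc%:R * dk%:R * dl%:R * dj%:R).
  by rewrite /z; field; rewrite !lt0r_neq0.
rewrite mulf_eq0 invr_eq0 !mulf_eq0 !(gt_eqF dc0, gt_eqF dk0, gt_eqF dl0, gt_eqF dj0).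
rewrite !orbF lin_eqE -(intr_eq0 rat).
by rewrite !(rmorphB, rmorphM) /=.
Qed.

Definition scalar_val k := fraction (component 2 k) (component 3 k) (denominator k).

Lemma field_relE c k l j : field_rel c k l j =
  (scalar_val j == scalar_val c * scalar_val k + scalar_val l).
Proof. exact: lin_eq_fraction. Qed.

(** For [S] past the last change of the candidate, this is the vector that [k] denotes in the
    end. *)
Definition vector_val f n S k : 'rV[rat]_n :=
  \row_(i < n) fraction (numerator f S i 2 k) (numerator f S i 3 k) (denominator k).

(** Both sides are compared at a stage beyond [S] and beyond all four codes: there the relation has
    settled, and so have the numerators. *)
Lemma space_relE f n S c k l j : (1 < n)%N ->
  (forall s, (S <= s)%N -> candidate f s = candidate f S) ->
  space_rel f n c k l j =
  (vector_val f n S j == scalar_val c *: vector_val f n S k + vector_val f n S l).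
Proof.
move=> n_gt1 stS; rewrite -(@space_rel_at_stable _ _ (maxn S (c + k + l + j))) //.
  rewrite /space_rel_at; apply/allP/eqP => [relP|/rowP valE i].
    apply/rowP => i; rewrite !mxE; apply/eqP.
    rewrite -lin_eq_fraction //.
    rewrite -!(numerator_stable _ _ _ stS (leq_maxl S (c + k + l + j))).
    by apply: relP; rewrite mem_iota /= add0n.
  rewrite mem_iota => /= lti; have := valE (Ordinal lti); rewrite !mxE => /eqP.
  by rewrite !(numerator_stable _ _ _ stS (leq_maxl _ _)) lin_eq_fraction.
exact: leq_maxr.
Qed.

(** Needed because a code carries a single denominator for all coordinates. *)
Lemma common_denominator (s : seq rat) : exists2 d : nat, (0 < d)%N &
  forall x, x \in s -> exists a b : nat, x = fraction a b d.
Proof.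
elim: s => [|y s [d d0 dP]]; first by exists 1%N.
have e0 : (0 < `|denq y|)%N by rewrite absz_gt0 denq_neq0.
exists (d * `|denq y|)%N => [|x]; first by rewrite muln_gt0 d0.
have d0' : d%:R != 0 :> rat by rewrite pnatr_eq0 -lt0n.
have e0' : `|denq y|%:R != 0 :> rat by rewrite pnatr_eq0 -lt0n.
rewrite inE => /predU1P[->|/dP[a [b ->]]]; last first.
  exists (a * `|denq y|)%N, (b * `|denq y|)%N.
  by rewrite /fraction !natrM; field; rewrite d0' ?e0'.
have yE : y = (numq y)%:~R / `|denq y|%:R.
  by rewrite -{1}[y]divq_num_den; congr (_ / _); rewrite -[in LHS]absz_denq.
case: (numq y) yE => m yE; [exists (m * d)%N, 0%N|exists 0%N, (m.+1 * d)%N].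
  by rewrite {1}yE /fraction !natrM pmulrn; field; rewrite d0' ?e0'.
by rewrite {1}yE /fraction !natrM NegzE mulrNz -pmulrn; field; rewrite d0' ?e0'.
Qed.

Lemma scalar_val_surj (x : rat) : exists k, scalar_val k == x.
Proof.
have [d d0 /(_ x (mem_head _ _))[a [b ->]]] := common_denominator [:: x].
exists (encode [:: 0; d.-1; a; b]%N).
by rewrite /scalar_val /denominator !component_encode /= prednK.
Qed.

Lemma vector_val_surj f n S (v : 'rV[rat]_n) : (1 < n)%N ->
  (forall s, (S <= s)%N -> candidate f s = candidate f S) ->
  exists k, vector_val f n S k == v.
Proof.
move=> n_gt1 stS.
have [d d0 dP] := common_denominator [seq v 0 i | i <- enum 'I_n].
have /fin_all_exists[a aP] : forall i, exists a, exists b, v 0 i = fraction a b d.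
  by move=> i; apply: dP; apply: map_f; rewrite mem_enum.
have {aP} /fin_all_exists[b abP] := aP.
(* Adding [S] to both numerators preserves their difference and makes the code at least [S], so the
   claim [candidate f S] is neither too large nor refuted. *)
pose ab (e : bool) i :=
  (S + if insub i is Some i' then if e then b i' else a i' else 0)%N.
pose k := encode [:: candidate f S, d.-1 & mkseq (fun j => ab (odd j) j./2) (n * 2)].
have kE (i : 'I_n) (e : bool) : component (i * 2 + (2 + e)) k = ab e i.
  rewrite component_encode (_ : (_ + _)%N = (i * 2 + e).+2) /=; last by lia.
  rewrite nth_mkseq; last by have := ltn_ord i; case: e; lia.
  by congr (ab _ _); case: e; lia.
have leSk : (S <= k)%N.
  apply: leq_trans (component_le 2 k); rewrite -[2%N]/(0 * 2 + (2 + false))%N.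
  by rewrite (kE (Ordinal (ltnW n_gt1))) leq_addr.
have numE (i : 'I_n) (e : bool) : numerator f S i (2 + e) k = ab e i.
  by rewrite /numerator component_encode /= (stS _ leSk) ltnn kE.
exists k; apply/eqP/rowP => i; rewrite mxE abP (numE i false) (numE i true).
rewrite /denominator component_encode /= prednK // /ab valK /fraction.
by rewrite !natrD; congr (_ / _); ring.
Qed.

(** * The coded space *)

Local Open Scope nat_scope.

Section ComputableRelations.

Variables (I : Type) (o : I -> baire).
Local Notation computable := (computable o).

Lemma computable_candidate k F : computable k F ->
  computable k (fun i xs => candidate (o i) (F i xs)).
Proof.
apply: (@computable_call1 _ _ _ (fun i => candidate (o i))).
rewrite /candidate; apply: computable_iteri; computability.
by apply: computable_oracle; computability.
Qed.

Lemma computable_growth k F : computable k F ->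
  computable k (fun i xs => growth (F i xs)).
Proof.
apply: (@computable_call1 _ _ _ (fun _ => growth)).
rewrite /growth; apply: computable_iteri; computability.
apply: (@computable_ext _ _ _ (fun _ xs => (nth 0 xs 0).+1 *
  ((nth 0 xs 0).+1 * ((nth 0 xs 0).+1 * (nth 0 xs 0).+1)))) => [i xs _|].
  by rewrite !expnS expn0 muln1.
computability.
Qed.

Lemma computable_collapse_stage k F G : computable k F -> computable k G ->
  computable k (fun i xs => collapse_stage (o i) (F i xs) (G i xs)).
Proof.
apply: (@computable_call2 _ _ _ (fun i => collapse_stage (o i))).
rewrite /collapse_stage.
apply: (@computable_sum _ _ _ _ (fun i t xs => candidate (o i) t <= nth 0 xs 0 : nat));
  computability.
by apply: computable_candidate; computability.
Qed.

Lemma computable_numerator k F1 F2 F3 F4 :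
  computable k F1 -> computable k F2 -> computable k F3 -> computable k F4 ->
  computable k
    (fun i xs => numerator (o i) (F1 i xs) (F2 i xs) (F3 i xs) (F4 i xs)).
Proof.
apply: (@computable_call4 _ _ _ (fun i => numerator (o i))).
rewrite /numerator; computability.
- by apply: computable_candidate; computability.
- by apply: computable_candidate; computability.
- by apply/computable_growth/computable_collapse_stage; computability.
Qed.

Lemma computable_field_rel k F1 F2 F3 F4 :
  computable k F1 -> computable k F2 -> computable k F3 -> computable k F4 ->
  computable k (fun i xs => field_rel (F1 i xs) (F2 i xs) (F3 i xs) (F4 i xs)).
Proof.
apply: (@computable_call4 _ _ _ (fun _ c k l j => field_rel c k l j : nat)).
rewrite /field_rel /lin_eq /denominator; computability.
Qed.

Lemma computable_space_rel n k F1 F2 F3 F4 :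
  computable k F1 -> computable k F2 -> computable k F3 -> computable k F4 ->
  computable k
    (fun i xs => space_rel (o i) n (F1 i xs) (F2 i xs) (F3 i xs) (F4 i xs)).
Proof.
apply: (@computable_call4 _ _ _ (fun i c k l j => space_rel (o i) n c k l j : nat)).
rewrite /space_rel /space_rel_at /lin_eq /denominator; computability;
  by apply: computable_numerator; computability.
Qed.

End ComputableRelations.

(** * Least codes as unique representatives *)

Section MinimalCode.

Variables (X : eqType) (val : nat -> X).
Hypothesis val_surj : forall x, exists k, val k == x.

Definition minimal_code x := ex_minn (val_surj x).

Lemma minimal_codeK : cancel minimal_code val.
Proof. by move=> x; rewrite /minimal_code; case: ex_minnP => k /eqP. Qed.

Lemma minimal_code_inj : injective minimal_code.
Proof. exact: can_inj minimal_codeK. Qed.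

Lemma ex_minn_minimal_code x (P : pred nat) (exP : exists k, P k) :
  (forall k, P k = (val k == x)) -> ex_minn exP = minimal_code x.
Proof.
move=> PE; rewrite /minimal_code.
case: ex_minnP => k; rewrite PE => kP kmin; case: ex_minnP => k' k'P k'min.
by apply/eqP; rewrite eqn_leq k'min // kmin // PE.
Qed.

(** Being the least code of a value is a bounded search, so the universe of the presentation is
    decidable. *)
Lemma minimal_codeP k :
  reflect (exists x, minimal_code x = k) (all (fun j => val j != val k) (iota 0 k)).
Proof.
apply: (iffP allP) => [kmin|[x <-] j].
  exists (val k); rewrite /minimal_code; case: ex_minnP => j /eqP jk jmin.
  apply/eqP; rewrite eqn_leq jmin // leqNgt; apply/negP => ltjk.
  by have := kmin j; rewrite mem_iota /= add0n ltjk jk eqxx => /(_ isT).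
rewrite mem_iota minimal_codeK /minimal_code; case: ex_minnP => i _ imin.
by apply: contraTneq => /eqP/imin; rewrite -leqNgt.
Qed.

End MinimalCode.

Definition C_N_instance := {f : baire | is_instance C_N f}.

(** Denominator 1 and positive numerator 1; the negative numerator is 0 by default, past the end of
    the list. *)
Definition one_code := encode [:: 0; 0; 1].

Lemma scalar_val1 : scalar_val one_code = 1%R.
Proof.
by rewrite /scalar_val /denominator /fraction !component_encode /= divr1 subr0.
Qed.

Lemma component0 i : component i 0 = 0.
Proof. by apply/eqP; rewrite -leqn0 component_le. Qed.

Lemma scalar_val0 : scalar_val 0 = 0%R.
Proof. by rewrite /scalar_val /fraction !component0 subrr mul0r. Qed.

Lemma vector_val0 f n S : vector_val f n S 0 = 0%R.
Proof.
apply/rowP => i; rewrite !mxE /fraction.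
have N0 off : numerator f S i off 0 = 0.
  by rewrite /numerator !component0 muln0 addn0 !if_same.
by rewrite !N0 subrr mul0r.
Qed.

(** * The presentation of Q^n by least codes *)

Section RationalSpace.

Variables (n : nat) (n_gt1 : 1 < n).

Lemma field_rel_ex c k l : exists j, field_rel c k l j.
Proof.
have [j jP] := scalar_val_surj (scalar_val c * scalar_val k + scalar_val l).
by exists j; rewrite field_relE.
Qed.

(** The final values of codes exist because the candidate stabilizes, which rests on [f] being an
    instance; this is why oracles are indexed by [C_N_instance]. *)
Lemma space_rel_ex (i : C_N_instance) c k l :
  exists j, space_rel (sval i) n c k l j.
Proof.
have [S stS] := candidate_stable (proj2_sig i).
have [j jP] := vector_val_surj
  (scalar_val c *: vector_val (sval i) n S k + vector_val (sval i) n S l)%R n_gt1 stS.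
by exists j; rewrite (space_relE _ _ _ _ n_gt1 stS).
Qed.

Definition scalar_op c k l := ex_minn (field_rel_ex c k l).
Definition vector_op (i : C_N_instance) c k l := ex_minn (space_rel_ex i c k l).

(** With scalar 1 and summand 0 the relation is equality of values, so the test accepts exactly the
    least codes. *)
Definition rat_scalar k :=
  all (fun j => ~~ field_rel one_code k 0 j) (iota 0 k).
Definition rat_vector (i : C_N_instance) k :=
  all (fun j => ~~ space_rel (sval i) n one_code k 0 j) (iota 0 k).

(** Columns 3 and 8, the two zeros, fall under the final default: 0 is the least code of either
    zero. Column 4 finds the least code of 1 as that of 1 times 1. *)
Definition coded_space (i : C_N_instance) m : nat :=
  if fst_code m == 0 then nat_of_bool (rat_scalar (snd_code m)) else
  if fst_code m == 1 then
    scalar_op one_code (fst_code (snd_code m)) (snd_code (snd_code m)) else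
  if fst_code m == 2 then
    scalar_op (fst_code (snd_code m)) (snd_code (snd_code m)) 0 else
  if fst_code m == 4 then scalar_op one_code one_code 0 else
  if fst_code m == 5 then nat_of_bool (rat_vector i (snd_code m)) else
  if fst_code m == 6 then
    vector_op i one_code (fst_code (snd_code m)) (snd_code (snd_code m)) else
  if fst_code m == 7 then
    vector_op i (fst_code (snd_code m)) (snd_code (snd_code m)) 0 else 0.

Lemma computable_scalar_op k F1 F2 F3 :
  computable (@sval _ _ : C_N_instance -> baire) k F1 ->
  computable (@sval _ _ : C_N_instance -> baire) k F2 ->
  computable (@sval _ _ : C_N_instance -> baire) k F3 ->
  computable (@sval _ _ : C_N_instance -> baire) k
    (fun i xs => scalar_op (F1 i xs) (F2 i xs) (F3 i xs)).
Proof.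
apply: (@computable_call3 _ _ _ (fun _ => scalar_op)).
apply: (@computable_mu _ _ _ _ (fun _ j xs =>
  field_rel (nth 0 xs 0) (nth 0 xs 1) (nth 0 xs 2) j)) => [|i xs _].
  by apply: computable_field_rel; computability.
by rewrite /scalar_op; case: ex_minnP.
Qed.

Lemma computable_vector_op k F1 F2 F3 :
  computable (@sval _ _ : C_N_instance -> baire) k F1 ->
  computable (@sval _ _ : C_N_instance -> baire) k F2 ->
  computable (@sval _ _ : C_N_instance -> baire) k F3 ->
  computable (@sval _ _ : C_N_instance -> baire) k
    (fun i xs => vector_op i (F1 i xs) (F2 i xs) (F3 i xs)).
Proof.
apply: (@computable_call3 _ _ _ vector_op).
apply: (@computable_mu _ _ _ _ (fun i j xs =>
  space_rel (sval i) n (nth 0 xs 0) (nth 0 xs 1) (nth 0 xs 2) j)) => [|i xs _].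
  by apply: computable_space_rel; computability.
by rewrite /vector_op; case: ex_minnP.
Qed.

Lemma computable_coded_space :
  computable (@sval _ _ : C_N_instance -> baire) 1
    (fun i xs => coded_space i (nth 0 xs 0)).
Proof.
rewrite /coded_space /rat_scalar /rat_vector; computability;
  by [apply: computable_field_rel; computability
     |apply: computable_space_rel; computability
     |apply: computable_scalar_op; computability
     |apply: computable_vector_op; computability].
Qed.

Variables (i : C_N_instance) (S : nat).
Let f := sval i.
Hypothesis stS : forall s, S <= s -> candidate f s = candidate f S.

Definition scalar_code := minimal_code scalar_val_surj.
Definition vector_code := minimal_code (fun v => vector_val_surj v n_gt1 stS).

Lemma scalar_opE c k l : scalar_op c k l =
  scalar_code (scalar_val c * scalar_val k + scalar_val l)%R.
Proof. by apply: ex_minn_minimal_code => j; rewrite field_relE. Qed.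

Lemma vector_opE c k l : vector_op i c k l = vector_code
  (scalar_val c *: vector_val f n S k + vector_val f n S l)%R.
Proof.
by apply: ex_minn_minimal_code => j; rewrite (space_relE _ _ _ _ n_gt1 stS).
Qed.

Lemma coded_spaceE a k : column (coded_space i) a k =
  if a == 0 then nat_of_bool (rat_scalar k) else
  if a == 1 then
    scalar_op one_code (fst_code k) (snd_code k) else
  if a == 2 then
    scalar_op (fst_code k) (snd_code k) 0 else
  if a == 4 then scalar_op one_code one_code 0 else
  if a == 5 then nat_of_bool (rat_vector i k) else
  if a == 6 then
    vector_op i one_code (fst_code k) (snd_code k) else
  if a == 7 then
    vector_op i (fst_code k) (snd_code k) 0 else 0.
Proof. by rewrite /column /coded_space fst_code_pair snd_code_pair. Qed.

Lemma coded_spaceP : codes_space (coded_space i) scalar_code vector_code.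
Proof.
have scalarK := @minimal_codeK _ _ scalar_val_surj.
have vectorK := @minimal_codeK _ _ (fun v => vector_val_surj v n_gt1 stS).
split; split; rewrite /op2.
- exact: minimal_code_inj.
- move=> k; rewrite coded_spaceE /=.
  rewrite /rat_scalar (eq_all (a2 := fun j => scalar_val j != scalar_val k)).
    by case: (minimal_codeP scalar_val_surj k) => ?; [left|right].
  by move=> j; rewrite field_relE scalar_val1 scalar_val0 mul1r addr0.
- move=> a b; rewrite coded_spaceE /= fst_code_pair snd_code_pair.
  by rewrite scalar_opE scalar_val1 mul1r !scalarK.
- move=> a b; rewrite coded_spaceE /= fst_code_pair snd_code_pair.
  by rewrite scalar_opE scalar_val0 addr0 !scalarK.
- rewrite !coded_spaceE /= scalar_opE scalar_val1 scalar_val0.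
  rewrite mulr1 addr0; split=> //; apply/esym/eqP.
  rewrite -leqn0 /scalar_code /minimal_code; case: ex_minnP => j _; apply.
  by rewrite scalar_val0.
- exact: minimal_code_inj.
- move=> k; rewrite coded_spaceE /=.
  rewrite /rat_vector (eq_all (a2 := fun j => vector_val f n S j != vector_val f n S k)).
    by case: (minimal_codeP (fun v => vector_val_surj v n_gt1 stS) k) => ?; [left|right].
  move=> j; rewrite (space_relE _ _ _ _ n_gt1 stS) scalar_val1 vector_val0.
  by rewrite scale1r addr0.
- move=> u v; rewrite coded_spaceE /= fst_code_pair snd_code_pair.
  by rewrite vector_opE scalar_val1 scale1r !vectorK.
- move=> a v; rewrite coded_spaceE /= fst_code_pair snd_code_pair.
  by rewrite vector_opE vector_val0 addr0 vectorK scalarK.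
- rewrite coded_spaceE /=; apply/esym/eqP.
  rewrite -leqn0 /vector_code /minimal_code; case: ex_minnP => j _; apply.
  by rewrite vector_val0.
Qed.

End RationalSpace.

(** * Reading a solution off a basis *)

Lemma sum_mem_uniq (s : seq nat) t : uniq s ->
  \sum_(k < t) (nat_of_ord k \in s : nat) = count (fun k => k < t) s.
Proof.
elim: s => [|x s IH] /=; first by rewrite big1.
case/andP=> xs /IH <-; under eq_bigr => k _ do rewrite inE.
have -> : (x < t : nat) = \sum_(k < t) (k == x :> nat : nat).
  have [ltx|lex] := ltnP x t.
    rewrite (bigD1 (Ordinal ltx)) //= eqxx big1 // => k.
    by rewrite -val_eqE /= => /negPf ->.
  rewrite big1 // => k _; case: eqP => // kx; move: (ltn_ord k); lia.
rewrite -big_split; apply: eq_bigr => k _ /=.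
by case: eqP => // ->; rewrite (negPf xs).
Qed.

(** A characteristic function gives no bound on its set. Knowing that the set has [n] elements, a
    search finds a bound below which all of them lie, and this makes the maximum computable. *)
Definition finite_set_instance n := {R : baire | exists t, \sum_(k < t) R k == n}.

Definition largest_claim n (R : finite_set_instance n) : nat :=
  iteri (ex_minn (proj2_sig R))
    (fun k z => maxn z (sval R k * component 0 k)) 0.

Lemma computable_largest_claim n :
  computable (@sval _ _ : finite_set_instance n -> baire) 1
    (fun R _ => largest_claim R).
Proof.
rewrite /largest_claim; apply: computable_iteri; last exact: computable_const.
  apply: (@computable_mu _ _ _ _ (fun (R : finite_set_instance n) t _ =>
    \sum_(k < t) sval R k == n)).
    apply: computable_eq; last exact: computable_const.
    apply: (@computable_sum _ _ _ _ 
      (fun (R : finite_set_instance n) k _ => sval R k)); computability.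
    by apply: computable_oracle; computability.
  by move=> R xs _; case: ex_minnP.
apply: (@computable_ext _ _ _ (fun (R : finite_set_instance n) xs => nth 0 xs 1 +
  (sval R (nth 0 xs 0) * component 0 (nth 0 xs 0) - nth 0 xs 1))).
  by move=> R xs _; rewrite maxnE.
by computability; apply: computable_oracle; computability.
Qed.

Lemma largest_claimE n (R : finite_set_instance n) (s : seq nat) m :
  uniq s -> size s = n ->
  (forall k, sval R k = (k \in s)) ->
  (forall k, k \in s -> component 0 k <= m) ->
  has (fun k => component 0 k == m) s -> largest_claim R = m.
Proof.
move=> s_uniq s_size Rs claim_le /hasP[k0 k0s /eqP k0m].
have claimE t : iteri t (fun k z => maxn z (sval R k * component 0 k)) 0 =
    \max_(k < t) (sval R k * component 0 k).
  by elim: t => [|t /= ->]; rewrite ?big_ord0 ?big_ord_recr.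
rewrite /largest_claim claimE; case: ex_minnP => t /eqP sum_t _.
(* The [n] elements counted below [t] exhaust [s]. *)
have /allP lt_t : all (fun k => k < t) s.
  rewrite all_count s_size -[X in _ == X]sum_t -(sum_mem_uniq _ s_uniq).
  by apply/eqP/eq_bigr => k _; rewrite Rs.
apply/eqP; rewrite eqn_leq; apply/andP; split.
  apply/bigmax_leqP => k _; rewrite Rs.
  by case: (boolP (nat_of_ord k \in s)) => [/claim_le|_]; rewrite ?mul1n.
rewrite -k0m; apply: leq_trans (leq_bigmax (Ordinal (lt_t _ k0s))).
by rewrite /= Rs k0s mul1n.
Qed.

(** Two spaces coded by the same [p] may be different types; closed properties
    are carried from one to the other along the codes. *)
Lemma basis_ind_coded p (K K' : fieldType) (V : vectType K) (V' : vectType K')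
    (cK : K -> nat) (cV : V -> nat) (cK' : K' -> nat) (cV' : V' -> nat)
    (b : seq V') (P : V -> Prop) :
  codes_space p cK cV -> codes_space p cK' cV' -> basis_of fullv b ->
  P 0%R -> (forall a u v, P u -> P v -> P (a *: u + v)%R) ->
  (forall u v, u \in b -> cV v = cV' u -> P v) -> forall v, P v.
Proof.
move=> pV pV' bB P0 Plin Pb.
have [[injK _ _ _ _] [injV _ addV scaleV zeroV]] := pV.
have [_ [_ _ addV' scaleV' zeroV']] := pV'.
suff PV' : forall u v, cV v = cV' u -> P v.
  move=> v; have [u /esym] : exists u, cV' u = cV v.
    by apply/(column_vec pV')/(column_vec pV); exists v.
  exact: PV'.
(* The expansion of [u] in [b] is carried over term by term: the universes agree, so coefficient,
   basis vector and remainder each have a counterpart with the same code. *)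
move=> u; rewrite (coord_basis (X := in_tuple b) bB (memvf u)).
elim/big_rec: _ => [v|i u' _ IH v vE].
  by rewrite -zeroV' zeroV => /injV ->.
have [a aE] : exists a, cK a = cK' (coord (in_tuple b) i u).
  apply/(column_scalar pV)/(column_scalar pV'); by eexists.
have [v1 v1E] : exists v1, cV v1 = cV' (b`_i)%R.
  by apply/(column_vec pV)/(column_vec pV'); eexists.
have [v2 v2E] : exists v2, cV v2 = cV' u'.
  by apply/(column_vec pV)/(column_vec pV'); eexists.
rewrite (injV v (a *: v1 + v2)%R).
  by apply: Plin; [apply: Pb v1E; apply: mem_nth|apply: IH].
by rewrite vE -addV' -scaleV' -addV -scaleV aE v1E v2E.
Qed.

Section LargestClaim.

Variables (n : nat) (n_gt1 : 1 < n) (i : C_N_instance) (S : nat).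
Let f := sval i.
Hypothesis stS : forall s, S <= s -> candidate f s = candidate f S.

Let cV := vector_code n_gt1 stS.
Let cVK : cancel cV (vector_val f n S) := minimal_codeK _.

(** A claim above the final candidate is above every candidate, so it is too large when its code is
    reached and the code denotes 0. *)
Lemma claim_vector_code v : v != 0%R -> component 0 (cV v) <= candidate f S.
Proof.
apply: contraNT; rewrite -ltnNge => claim_gt; rewrite -(cVK v).
have invalid : candidate f (cV v) < component 0 (cV v).
  apply: leq_ltn_trans claim_gt; rewrite -(stS (leq_maxl S (cV v))).
  exact: candidate_mono (leq_maxr _ _).
by apply/eqP/rowP => j; rewrite !mxE /fraction /numerator invalid subrr mul0r.
Qed.

Lemma dead_vector_code v : component 0 (cV v) < candidate f S ->
  v ord0 (Ordinal n_gt1) = 0%R.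
Proof.
move=> dead; rewrite -(cVK v) mxE /fraction /numerator dead /=.
by rewrite !if_same subrr mul0r.
Qed.

(** Basis vectors are nonzero, which bounds their claims. If none claimed the final candidate,
    coordinate 1 would vanish on the basis and hence everywhere, but it is 1 on the constant
    vector. *)
Lemma basis_largest_claim (K' : fieldType) (V' : vectType K')
    (cK' : K' -> nat) (cV' : V' -> nat) (b : seq V') :
  codes_space (coded_space n_gt1 i) cK' cV' -> basis_of fullv b ->
  (forall u, u \in b -> component 0 (cV' u) <= candidate f S) /\
  has (fun u => component 0 (cV' u) == candidate f S) b.
Proof.
move=> pV' bB; have pV := coded_spaceP n_gt1 stS.
have vecE u : exists v, cV v = cV' u.
  by apply/(column_vec pV)/(column_vec pV'); exists u.
have claim_le u : u \in b -> component 0 (cV' u) <= candidate f S.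
  move=> ub; have [v vE] := vecE u; rewrite -vE; apply: claim_vector_code.
  (* Both zero vectors have the code stored in column 8. *)
  apply: contraTneq ub => v0; have : cV' u = cV' 0%R.
    case: pV pV' => _ [_ _ _ _ zeroV] [_ [_ _ _ _ zeroV']].
    by rewrite -vE v0; apply: etrans (esym zeroV) zeroV'.
  case: pV' => _ [injV' _ _ _ _] /injV' ->.
  by apply/negP => /(free_not0 (basis_free bB)); rewrite eqxx.
split=> //; apply/negPn/negP => /hasPn no_claim.
have /(_ (const_mx 1%R)) : forall v : 'rV[rat]_n, v ord0 (Ordinal n_gt1) = 0%R.
  apply: (basis_ind_coded pV pV' bB) => [|a u v u0 v0|u v ub vE].
  - by rewrite mxE.
  - by rewrite !mxE u0 v0 mulr0 addr0.
  - apply: dead_vector_code; rewrite ltn_neqAle [cV v]vE claim_le // andbT.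
    exact: no_claim.
by rewrite mxE => /eqP; rewrite oner_eq0.
Qed.

End LargestClaim.

Lemma C_N_le_VSB n : 1 < n -> sW_le C_N (VSB n).
Proof.
move=> n_gt1; have [Phi PhiP] := computable_coded_space n_gt1.
have [Psi PsiP] := computable_largest_claim n.
exists Phi, Psi => f f_inst; pose i : C_N_instance := exist _ f f_inst.
have [S stS] := candidate_stable f_inst.
exists (coded_space n_gt1 i); split.
- by move=> k; apply: (PhiP i [:: k]).
- exists rat, 'rV[rat]_n, scalar_code, (vector_code (i := i) n_gt1 stS); split.
    exact: coded_spaceP.
  by rewrite dimvf /dim /= mul1n.
move=> R [K' [V' [cK' [cV' [pV' dimV' [b bB Rb]]]]]].
have [claim_le claim_eq] := basis_largest_claim (i := i) stS pV' bB.
pose s := map cV' b.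
have s_uniq : uniq s.
  rewrite map_inj_uniq; first exact: free_uniq (basis_free bB).
  by case: pV' => _ [].
have s_size : size s = n.
  by rewrite size_map -dimV' (size_basis (X := in_tuple b) bB).
have Rs k : R k = (k \in s).
  case: (Rb k) => -[bk ->].
    by case: bk => v vb <-; rewrite map_f.
  case: mapP => // -[v vb kv]; case: bk; by exists v.
have Rfin : exists t, \sum_(k < t) R k == n.
  (* This bound exceeds every element of [s], so all [n] of them are counted. *)
  exists (\max_(k <- s) k.+1); set t := \max_(k <- s) k.+1.
  rewrite (eq_bigr (fun k : 'I_t => (nat_of_ord k \in s : nat))) => [|k _].
    rewrite sum_mem_uniq // -s_size -all_count; apply/allP => k ks.
    exact: (@leq_bigmax_seq _ s xpredT succn).
  by rewrite Rs.
pose R' : finite_set_instance n := exist _ R Rfin.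
exists (fun=> largest_claim R'); split; first by move=> k; apply: (PsiP R' [:: k]).
move=> k /=; rewrite (largest_claimE (R := R') s_uniq s_size Rs (m := candidate f S)).
- exact: candidate_stable_notin.
- by move=> _ /mapP[u ub ->]; apply: claim_le.
- by rewrite has_map.
Qed.

Theorem theorem3p7 (n : nat) (hn : 2 <= n) : sW_equiv (VSB n) C_N.
Proof. by split; [apply: VSB_le_C_N|apply: C_N_le_VSB]. Qed.
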